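(* Let $d,N\ge1$ be integers and let $\boldsymbol v_\theta:\mathbb{R}^d\times[0,1]\to\mathbb{R}^d$ be a smooth vector field such that for every multi-index $\beta\in\mathbb{N}_0^{d+1}$ (including $\beta=0$) there is a constant $M_\beta$ with $\sup_{\mathbf x\in\mathbb{R}^d,\,t\in[0,1]}|\partial^\beta\boldsymbol v_\theta(\mathbf x,t)|\le M_\beta$. Let $\boldsymbol\tau:(0,1)^d\to\mathbb{R}^d$ be the composition of the component-wise inverse logistic map $G$ with $N$ Euler steps for $\boldsymbol v_\theta$ (see context). Then for all $m,j\in\{1,\dots,d\}$, all $v\subseteq\{1,\dots,d\}$ and every $B>0$ there is a constant $C_3>0$ such that for all $\mathbf u\in(0,1)^d$, $$|\partial^v(\partial^{\{m\}}\boldsymbol\tau_j)(\mathbf u)|\le C_3\,\min(u_m,1-u_m)^{-1}\prod_{k=1}^d\min(u_k,1-u_k)^{-B-\mathbf 1_{\{k\in v\}}} .$$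
   Context: $G(\mathbf u)=(G(u_1),\dots,G(u_d))$ with $G(u)=\log\frac{u}{1-u}$ for $u\in(0,1)$. With step size $\eta=1/N$ and $t_k=k\eta$, the Euler step maps are $\boldsymbol\tau^k(\mathbf x)=\mathbf x+\eta\,\boldsymbol v_\theta(\mathbf x,t_k)$, $k=0,\dots,N-1$, and $\boldsymbol\tau=\boldsymbol\tau^{N-1}\circ\cdots\circ\boldsymbol\tau^0\circ G$. $\boldsymbol\tau_j$ is the $j$-th component of $\boldsymbol\tau$. For $v\subseteq\{1,\dots,d\}$, $\partial^v=\prod_{j\in v}\partial/\partial u_j$, with $\partial^\emptyset$ the identity; in particular $\partial^{\{m\}}=\partial/\partial u_m$, and $\partial^v\partial^{\{m\}}$ is a second derivative in $u_m$ when $m\in v$. *)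

(* Defs.v *)
(* MathComp-Analysis *)
From mathcomp Require Import all_boot all_order all_algebra.
From mathcomp Require Import all_classical all_reals all_analysis.

Set Implicit Arguments.
Unset Strict Implicit.
Unset Printing Implicit Defensive.

Import Order.TTheory GRing.Theory Num.Theory.
Import numFieldNormedType.Exports.

Local Open Scope classical_set_scope.
Local Open Scope ring_scope.

(** Calculus on a domain D of R^d x R that need not be open: difference
    quotients only use increments that stay in D, so that on R^d x [0,1] the
    time derivatives at t = 0 and t = 1 are one-sided and the values of a
    function outside D are irrelevant. *)

Definition spacetime_dir (R : realType) (d : nat) (i : 'I_(d + 1)) :
    'rV[R]_d * R :=
  match fintype.split i with
  | inl k => (delta_mx 0 k, 0)
  | inr _ => (0, 1)
  end.

Definition quotient_on (R : realType) (d : nat) (W : normedModType R)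
    (D : set ('rV[R]_d * R)) (i : 'I_(d + 1)) (f : 'rV[R]_d * R -> W)
    (p : 'rV[R]_d * R) : set_system W :=
  h^-1 *: (f (p + h *: spacetime_dir R i) - f p)
    @[h --> within [set h | D (p + h *: spacetime_dir R i)] (0 : R)^'].

Definition partial_on (R : realType) (d : nat) (W : normedModType R)
    (D : set ('rV[R]_d * R)) (i : 'I_(d + 1)) (f : 'rV[R]_d * R -> W) :
    'rV[R]_d * R -> W :=
  fun p => lim (quotient_on D i f p).

Definition partials_on (R : realType) (d : nat) (W : normedModType R)
    (D : set ('rV[R]_d * R)) (s : seq 'I_(d + 1)) (f : 'rV[R]_d * R -> W) :
    'rV[R]_d * R -> W :=
  foldr (fun i g => partial_on D i g) f s.

(* All iterated partial derivatives, in any order, exist and are continuous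
   on D. *)
Definition smooth_on (R : realType) (d : nat) (W : normedModType R)
    (D : set ('rV[R]_d * R)) (f : 'rV[R]_d * R -> W) : Prop :=
  forall s : seq 'I_(d + 1),
    {within D, continuous (partials_on D s f)} /\
    forall (i : 'I_(d + 1)) (p : 'rV[R]_d * R),
      D p -> cvg (quotient_on D i (partials_on D s f) p).

(* The last of the d + 1 indices is the time variable. *)
Definition multi_partial_on (R : realType) (d : nat) (W : normedModType R)
    (D : set ('rV[R]_d * R)) (beta : 'I_(d + 1) -> nat)
    (f : 'rV[R]_d * R -> W) : 'rV[R]_d * R -> W :=
  partials_on D (flatten [seq nseq (beta i) i | i <- enum 'I_(d + 1)]) f.

Definition slab (R : realType) (d : nat) : set ('rV[R]_d * R) :=
  [set p | 0 <= p.2 <= 1].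

Definition Glogit (R : realType) (u : R) : R := ln (u / (1 - u)).

Definition euler_step (R : realType) (d N : nat)
    (vtheta : 'rV[R]_d * R -> 'rV[R]_d) (k : nat) (x : 'rV[R]_d) : 'rV[R]_d :=
  let eta : R := N%:R^-1 in
  x + eta *: vtheta (x, k%:R * eta).

Fixpoint euler_iter (R : realType) (d N : nat)
    (vtheta : 'rV[R]_d * R -> 'rV[R]_d) (n : nat) (x : 'rV[R]_d) : 'rV[R]_d :=
  if n is k.+1 then euler_step N vtheta k (euler_iter N vtheta k x) else x.

Definition tau (R : realType) (d N : nat)
    (vtheta : 'rV[R]_d * R -> 'rV[R]_d) (u : 'rV[R]_d) : 'rV[R]_d :=
  euler_iter N vtheta N (map_mx (@Glogit R) u).

Definition open_cube (R : realType) (d : nat) : set 'rV[R]_d :=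
  [set u : 'rV[R]_d | forall k : 'I_d, 0 < u 0 k < 1].

Definition mixed_partial (R : realType) (d : nat) (v : {set 'I_d})
    (f : 'rV[R]_d -> R) : 'rV[R]_d -> R :=
  foldr (fun k (g : 'rV[R]_d -> R) => 'D_(delta_mx 0 k) g) f (enum v).

(* Main.v *)
(** The logit G has derivative w(u) = 1 / (u (1 - u)).  Measure derivatives on
    the open cube in units of w: call f weighted-smooth if f is bounded and each
    derivative in direction k is w(u_k) times a weighted-smooth function.  Such
    functions form an algebra containing the coordinates, and F (g u) is one as
    soon as F is smooth with bounded derivatives and each component of g has a
    weighted-smooth gradient, g itself being possibly unbounded.  By induction
    over the Euler steps every component of tau has such a gradient.  As w' / w
    is w times the polynomial 2 u - 1, each further derivative in direction k
    produces exactly one more factor w(u_k).  Finally w(u) <= 2 / min(u, 1 - u),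
    and the factors min(u_k, 1 - u_k)^(-B) are at least 1.  The
    bounds assumed on the vector field concern partial derivatives taken in one
    fixed order; Clairaut's theorem extends them to every order. *)

Require Import Defs.
From mathcomp Require Import all_boot all_order all_algebra.
From mathcomp Require Import all_classical all_reals all_analysis.
From mathcomp Require Import ring lra.

Set Implicit Arguments.
Unset Strict Implicit.
Unset Printing Implicit Defensive.

Import Order.TTheory GRing.Theory Num.Theory.
Import numFieldNormedType.Exports.

Local Open Scope classical_set_scope.
Local Open Scope ring_scope.

(** * Mean values along lines and symmetry of second derivatives *)

Lemma is_derive_line (R : realType) (V W : normedModType R) (f : V -> W)
    (a x : V) (s : R) :
  derivable f (s *: a + x) a ->
  is_derive s 1 (fun s => f (s *: a + x)) ('D_a f (s *: a + x)).
Proof.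
have E : (fun h : R => h^-1 *: (((fun s => f (s *: a + x)) \o shift s) (h *: 1)
    - f (s *: a + x))) =
  (fun h => h^-1 *: ((f \o shift (s *: a + x)) (h *: a) - f (s *: a + x))).
  by apply/funext => h /=; rewrite [h *: 1]mulr1 scalerDl addrA.
by move=> df; split; rewrite /derivable /derive E.
Qed.

(** Locating [c] only through its absolute value gives one statement for both signs of [t]; later
    uses need only closeness to [x]. *)
Lemma MVT_line (R : realType) (V : normedModType R) (f : V -> R) (a x : V)
    (t : R) :
  (forall y, derivable f y a) ->
  exists2 c : R, `|c| <= `|t| &
    f (t *: a + x) - f x = t * 'D_a f (c *: a + x).
Proof.
move=> df; set phi := fun s : R => f (s *: a + x).
have dphi (s : R) : is_derive s 1 phi ('D_a f (s *: a + x)).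
  exact: is_derive_line.
have cphi b c : {within `[b, c], continuous phi}.
  by apply: derivable_within_continuous => s _; exact: ex_derive.
have phi0 : f x = phi 0 by rewrite /phi scale0r add0r.
have [t0|/ltW t0] := leP 0 t.
- have [c] := MVT_segment t0 (fun s _ => dphi s) (cphi _ _).
  rewrite in_itv /= => /andP[c0 ct]; rewrite phi0 subr0 mulrC => E.
  by exists c => //; rewrite !ger0_norm.
- have [c] := MVT_segment t0 (fun s _ => dphi s) (cphi _ _).
  rewrite in_itv /= => /andP[c0 ct]; rewrite phi0 sub0r => E.
  exists c; first by rewrite !ler0_norm ?lerN2.
  by rewrite -opprB E mulrN opprK mulrC.
Qed.

(** Mean values are taken twice: in direction [a] for y -> f (y + h b) - f y, then in direction [b]
    for the resulting increment of the [a]-derivative. The left side is symmetric in [a] and [b]. *)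
Lemma second_difference (R : realType) (V : normedModType R) (f : V -> R)
    (a b x : V) (h : R) :
  (forall y, derivable f y a) -> (forall y, derivable ('D_a f) y b) ->
  exists c1 c2 : R, [/\ `|c1| <= `|h|, `|c2| <= `|h| &
    f (h *: a + (h *: b + x)) - f (h *: b + x) - (f (h *: a + x) - f x) =
    h * h * 'D_b ('D_a f) (c2 *: b + (c1 *: a + x))].
Proof.
move=> dfa dfab.
pose g y := f (y + h *: b) - f y.
have shf y : is_derive y a (fun y => f (y + h *: b)) ('D_a f (y + h *: b)).
  have E : (fun k : R => k^-1 *:
      (((fun y => f (y + h *: b)) \o shift y) (k *: a) - f (y + h *: b))) =
    (fun k => k^-1 *:
      ((f \o shift (y + h *: b)) (k *: a) - f (y + h *: b))).
    by apply/funext => k /=; rewrite addrA.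
  have df := dfa (y + h *: b).
  by split; rewrite /derivable /derive E.
have dg y : is_derive y a g ('D_a f (y + h *: b) - 'D_a f y).
  by apply: is_deriveB; exact: derivableP.
have [c1 c1h Ec1] := @MVT_line R V g a x h
  (fun y => @ex_derive _ _ _ _ _ _ _ (dg y)).
have [c2 c2h Ec2] := @MVT_line R V ('D_a f) b (c1 *: a + x) h dfab.
exists c1, c2; split => //.
have -> : h *: a + (h *: b + x) = h *: a + x + h *: b by rewrite addrCA addrC.
rewrite addrAC (addrC (h *: b) x) opprB addrA.
rewrite -mulrA -Ec2 [h *: b + _]addrC.
have := Ec1; rewrite (@derive_val _ _ _ _ _ _ _ (dg _)) => <-.
by rewrite /g; ring.
Qed.

Lemma clairaut (R : realType) (V : normedModType R) (f : V -> R) (a b x : V) :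
  (forall y, derivable f y a) -> (forall y, derivable f y b) ->
  (forall y, derivable ('D_a f) y b) -> (forall y, derivable ('D_b f) y a) ->
  {for x, continuous ('D_b ('D_a f))} -> {for x, continuous ('D_a ('D_b f))} ->
  'D_b ('D_a f) x = 'D_a ('D_b f) x.
Proof.
move=> dfa dfb dfab dfba cab cba.
apply/eqP; rewrite -subr_eq0 -normr_le0; apply/ler_addgt0Pr => e e0.
rewrite add0r.
have e20 : 0 < e / 2 by rewrite divr_gt0.
have /cvgrPdist_lt /(_ _ e20) /nbhs_normP[r1 /= r10 H1] := cab.
have /cvgrPdist_lt /(_ _ e20) /nbhs_normP[r2 /= r20 H2] := cba.
(* [s] exceeds |a| + |b| and is positive even if both vanish, so h (|a| + |b|) stays below both
   radii. *)
pose s := `|a| + `|b| + 1.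
have s0 : 0 < s by rewrite /s ltr_wpDl ?addr_ge0.
pose h := Num.min r1 r2 / 2 / s.
have m0 : 0 < Num.min r1 r2 by rewrite lt_min r10.
have h0 : 0 < h by rewrite !divr_gt0.
have near_x (c c' : R) (a' b' : V) : `|c| <= `|h| -> `|c'| <= `|h| ->
    `|a'| + `|b'| = `|a| + `|b| ->
    `|x - (c *: a' + (c' *: b' + x))| < Num.min r1 r2.
  move=> ch c'h ab; rewrite distrC addrA addrK.
  apply: le_lt_trans (ler_normD _ _) _; rewrite !normrZ.
  apply: (@le_lt_trans _ _ (h * (`|a'| + `|b'|))).
    by rewrite mulrDr lerD // ler_wpM2r // -(gtr0_norm h0).
  rewrite ab; apply: (@lt_trans _ _ (h * s)).
    by rewrite ltr_pM2l // /s ltrDl.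
  by rewrite /h divfK ?gt_eqF // ltr_pdivrMr // ltr_pMr // ltr1n.
have [c1 [c2 [c1h c2h E1]]] := @second_difference R V f a b x h dfa dfab.
have [k1 [k2 [k1h k2h E2]]] := @second_difference R V f b a x h dfb dfba.
have hh : h * h != 0 by rewrite mulf_neq0 ?gt_eqF.
(* Both values equal the same second difference divided by h^2. *)
have E : 'D_b ('D_a f) (c2 *: b + (c1 *: a + x)) =
         'D_a ('D_b f) (k2 *: a + (k1 *: b + x)).
  apply: (mulfI hh); rewrite -E1 -E2.
  by rewrite (addrCA (h *: a)); ring.
have := near_x c2 c1 b a c2h c1h (addrC _ _).
have := near_x k2 k1 a b k2h k1h erefl.
rewrite !lt_min => /andP[_ K2] /andP[K1 _].
rewrite (splitr e) -(subrKA ('D_b ('D_a f) (c2 *: b + (c1 *: a + x)))).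
apply: le_trans (ler_normD _ _) _; apply: lerD.
  by apply/ltW/H1.
by rewrite E distrC; apply/ltW/H2.
Qed.

(** * Chain rule from continuous partial derivatives *)

Lemma row_norm_le (R : realType) (d : nat) (x : 'rV[R]_d) (M : R) :
  0 <= M -> (forall j, `|x 0 j| <= M) -> `|x| <= M.
Proof.
move=> M0 xM; rewrite /Num.norm /= mx_normrE; apply: bigmax_le => //.
by move=> [i j] _; rewrite ord1 /=; exact: xM.
Qed.

Lemma coord_norm_le (R : realType) (d : nat) (x : 'rV[R]_d) (j : 'I_d) :
  `|x 0 j| <= `|x|.
Proof.
rewrite [leRHS]/Num.norm /= mx_normrE.
exact: (le_bigmax _ (fun ij : 'I_1 * 'I_d => `|x ij.1 ij.2|) (0, j)).
Qed.

Lemma increment_partials (R : realType) (d : nat) (f : 'rV[R]_d -> R)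
    (x z : 'rV[R]_d) :
  (forall y i, derivable f y (delta_mx 0 i)) ->
  exists p : 'I_d -> 'rV[R]_d, (forall i, `|p i - x| <= `|z - x|) /\
    f z - f x = \sum_i (z 0 i - x 0 i) * 'D_(delta_mx 0 i) f (p i).
Proof.
move=> df.
(* A path from [x] to [z] parallel to the axes: [y k] has its first [k] coordinates from [z]. Mean
   values are taken on each leg and the increments telescope. *)
pose y (k : nat) := \row_(j < d) (if (j < k)%N then z 0 j else x 0 j).
have yS (k : 'I_d) : y k.+1 = (z 0 k - x 0 k) *: delta_mx 0 k + y k.
  apply/rowP => j; rewrite !mxE eqxx /=.
  have [->|jk] := eqVneq j k; first by rewrite ltnSn ltnn mulr1 subrK.
  by rewrite mulr0 add0r ltnS leq_eqVlt val_eqE (negbTE jk).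
have /choice[p Hp] (k : 'I_d) : exists p : 'rV[R]_d, `|p - x| <= `|z - x| /\
    f (y k.+1) - f (y k) = (z 0 k - x 0 k) * 'D_(delta_mx 0 k) f p.
  have [c ck E] := @MVT_line R _ f (delta_mx 0 k) (y k) (z 0 k - x 0 k)
     (fun y => df y k).
  exists (c *: delta_mx 0 k + y k); split; last by rewrite yS.
  apply: row_norm_le => // j; rewrite !mxE eqxx /=.
  have [->|jk] := eqVneq j k.
    rewrite ltnn mulr1 addrK; apply: le_trans ck _.
    by have := coord_norm_le (z - x) k; rewrite !mxE.
  rewrite mulr0 add0r; case: ifP => _.
    by have := coord_norm_le (z - x) j; rewrite !mxE.
  by rewrite subrr normr0.
exists p; split; first by move=> i; case: (Hp i).
have yd : y d = z by apply/rowP => j; rewrite mxE ltn_ord.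
have y0 : y 0%N = x by apply/rowP => j; rewrite mxE ltn0.
rewrite -{1}yd -{1}y0.
transitivity (\sum_(0 <= k < d) (f (y k.+1) - f (y k))).
  by rewrite (telescope_sumr (fun k => f (y k))).
by rewrite big_mkord; apply: eq_bigr => k _; case: (Hp k).
Qed.

Lemma is_derive_comp_partials (R : realType) (d : nat) (V : normedModType R)
    (f : 'rV[R]_d -> R) (g : V -> 'rV[R]_d) (y v : V) (dg : 'I_d -> R) :
  (forall x i, derivable f x (delta_mx 0 i)) ->
  (forall i, continuous ('D_(delta_mx 0 i) f)) ->
  (forall i, is_derive y v (fun w => g w 0 i) (dg i)) ->
  is_derive y v (fun w => f (g w)) (\sum_i 'D_(delta_mx 0 i) f (g y) * dg i).
Proof.
move=> df cf Dg.
have dgy : derivable g y v.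
  by apply/derivable_mxP => i j; rewrite ord1; exact: ex_derive.
(* Derivability in direction [v] gives continuity along that line, which forces the intermediate
   points [p h i] to tend to [g y]. *)
have cg : g (h *: v + y) @[h --> (0 : R)^'] --> g y.
  have /derivable1P/derivable1_diffP/differentiable_continuous := dgy.
  by move=> /continuous_withinNx; rewrite scale0r add0r.
have /choice[p Hp] (h : R) :=
  @increment_partials R d f (g y) (g (h *: v + y)) df.
have cp i : p h i @[h --> (0 : R)^'] --> g y.
  apply/cvgrPdist_le => e e0.
  move/cvgrPdist_le : cg => /(_ e e0); apply: filterS => h; rewrite distrC => H.
  by rewrite distrC; apply: le_trans H; case: (Hp h) => /(_ i).
have L : h^-1 *: (((fun w => f (g w)) \o shift y) (h *: v) - f (g y))
    @[h --> (0 : R)^'] --> \sum_i 'D_(delta_mx 0 i) f (g y) * dg i.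
  (* The difference quotient is an exact sum, without remainder, so the limit can be taken term by
     term. *)
  have -> : (fun h : R =>
      h^-1 *: (((fun w => f (g w)) \o shift y) (h *: v) - f (g y))) =
    fun h => \sum_i 'D_(delta_mx 0 i) f (p h i) *
       (h^-1 *: (((fun w => g w 0 i) \o shift y) (h *: v) - g y 0 i)).
    apply/funext => h /=; case: (Hp h) => _ ->.
    rewrite scaler_sumr; apply: eq_bigr => i _.
    by rewrite /GRing.scale /=; ring.
  apply: cvg_big => [|i _]; [exact: add_continuous | apply: cvgM].
    exact: (cvg_comp _ _ (cp i) (cf i (g y))).
  by have [dgi <-] := Dg i; exact: dgi.
by split; [apply/cvg_ex; eexists; exact: L | exact: cvg_lim L].
Qed.

(** * Slices of the slab at a fixed time *)

Definition iterated_partial (R : realType) (d : nat) (W : normedModType R)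
    (s : seq 'I_d) (f : 'rV[R]_d -> W) : 'rV[R]_d -> W :=
  foldr (fun i g => 'D_(delta_mx 0 i) g) f s.

Definition smooth (R : realType) (d : nat) (W : normedModType R)
    (f : 'rV[R]_d -> W) : Prop :=
  forall s, continuous (iterated_partial s f) /\
    forall i x, derivable (iterated_partial s f) x (delta_mx 0 i).

Lemma quotient_slab_space (R : realType) (d : nat) (W : normedModType R)
    (i : 'I_d) (f : 'rV[R]_d * R -> W) (x : 'rV[R]_d) (t : R) :
  0 <= t <= 1 ->
  quotient_on (@slab R d) (lshift 1 i) f (x, t) =
  (h^-1 *: (((fun x => f (x, t)) \o shift x) (h *: delta_mx 0 i) - f (x, t)))
    @[h --> (0 : R)^'].
Proof.
move=> t01; rewrite /quotient_on.
have -> : spacetime_dir R (lshift 1 i) = (delta_mx 0 i, 0).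
  by rewrite /spacetime_dir -[lshift 1 i]/(unsplit (inl i)) unsplitK.
have E (h : R) : (x, t) + h *: (delta_mx 0 i : 'rV[R]_d, 0 : R) =
    (h *: delta_mx 0 i + x, t).
  by congr pair; [exact: addrC | rewrite /= scaler0 addr0].
have -> : [set h : R | slab ((x, t) + h *: (delta_mx 0 i : 'rV[R]_d, 0 : R))]
    = setT.
  by apply/seteqP; split => // h _ /=; rewrite E.
by rewrite withinET; under eq_fun do rewrite E.
Qed.

Lemma iterated_partial_slab (R : realType) (d : nat) (W : normedModType R)
    (s : seq 'I_d) (f : 'rV[R]_d * R -> W) (t : R) :
  0 <= t <= 1 ->
  (fun x => partials_on (@slab R d) (map (lshift 1) s) f (x, t)) =
  iterated_partial s (fun x => f (x, t)).
Proof.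
move=> t01; elim: s => //= i s IH; apply/funext => x.
by rewrite /partial_on quotient_slab_space // /derive -IH.
Qed.

Lemma continuous_slice (R : realType) (d : nat) (W : normedModType R)
    (f : 'rV[R]_d * R -> W) (t : R) :
  0 <= t <= 1 -> {within @slab R d, continuous f} ->
  continuous (fun x : 'rV[R]_d => f (x, t)).
Proof.
move=> t01 cf.
(* The slice lies inside the slab, so its limits are limits within the slab even at the times 0 and
   1. *)
have into_slab (x : 'rV[R]_d) :
    (fun y : 'rV[R]_d => (y, t)) @ nbhs x --> within (@slab R d) (nbhs (x, t)).
  have cxt := @cvg_pair _ _ _ (nbhs x) (nbhs x) (nbhs t) (nbhs_filter x)
    (nbhs_filter x) (nbhs_filter t) id (fun=> t)
    (@cvg_id _ _) (@cvg_cst _ t _ _ (nbhs_filter x)).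
  move=> A wA; have H : nbhs x [set y | slab (y, t) -> A (y, t)] := cxt _ wA.
  by apply: (@filterS _ (nbhs x) (nbhs_filter x) _ _ _ H) => y /(_ t01).
move=> x; have xt : slab (x, t) by [].
have /subspace_continuousP/(_ _ xt) := cf.
exact: cvg_comp (into_slab x).
Qed.

Lemma smooth_slice (R : realType) (d : nat) (W : normedModType R)
    (f : 'rV[R]_d * R -> W) (t : R) :
  smooth_on (@slab R d) f -> 0 <= t <= 1 -> smooth (fun x => f (x, t)).
Proof.
move=> sf t01 s; rewrite -(iterated_partial_slab s f t01).
have [cs ds] := sf (map (lshift 1) s); split=> [x|i x].
- exact: continuous_slice cs x.
- by have := ds (lshift 1 i) (x, t) t01; rewrite quotient_slab_space.
Qed.

Lemma iterated_partial_coord (R : realType) (d e : nat)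
    (f : 'rV[R]_d -> 'rV[R]_e) (s : seq 'I_d) (j : 'I_e) :
  smooth f ->
  iterated_partial s (fun x => f x 0 j) = fun x => iterated_partial s f x 0 j.
Proof.
move=> sf; elim: s => //= i s IH; apply/funext => x.
by rewrite IH derive_mx ?mxE //; case: (sf s).
Qed.

Lemma smooth_coord (R : realType) (d e : nat) (f : 'rV[R]_d -> 'rV[R]_e)
    (j : 'I_e) :
  smooth f -> smooth (fun x => f x 0 j).
Proof.
move=> sf s; rewrite iterated_partial_coord //; have [cs ds] := sf s.
split=> [x|i x]; last by have /derivable_mxP := ds i x.
exact: (cvg_comp _ _ (cs x) (@coord_continuous _ _ _ 0 j _)).
Qed.

(** * Bounds on partial derivatives taken in any order *)

(** The direction [i] passes the entries of [s] one at a time, each exchange being [clairaut] for a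
    partial derivative of [f]. *)
Lemma iterated_partial_cons_cat (R : realType) (d : nat) (f : 'rV[R]_d -> R)
    (i : 'I_d) (s t : seq 'I_d) :
  smooth f ->
  iterated_partial (i :: s ++ t) f = iterated_partial (s ++ i :: t) f.
Proof.
move=> sf; elim: s => //= k s <-; apply/funext => x.
apply: clairaut => [y|y|y|y||]; try by case: (sf (s ++ t)).
- by case: (sf (k :: s ++ t)).
- by case: (sf (i :: s ++ t)).
- by case: (sf (i :: k :: s ++ t)) => /(_ x).
- by case: (sf (k :: i :: s ++ t)) => /(_ x).
Qed.

Lemma iterated_partial_perm (R : realType) (d : nat) (f : 'rV[R]_d -> R)
    (s t : seq 'I_d) :
  smooth f -> perm_eq s t -> iterated_partial s f = iterated_partial t f.
Proof.
move=> sf; elim: s t => [|i s IH] t st.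
  by move: st; rewrite perm_sym => /perm_nilP ->.
have it : i \in t by rewrite -(perm_mem st) mem_head.
case/splitPr: it st => t1 t2; rewrite perm_sym perm_catC /= perm_cons => st.
rewrite -iterated_partial_cons_cat //= (IH (t1 ++ t2)) //.
by rewrite perm_sym perm_catC.
Qed.

(** The left side lists the entries of [s] in the fixed order in which [multi_partial_on]
    differentiates. *)
Lemma perm_flatten_nseq (T : finType) (s : seq T) :
  perm_eq (flatten [seq nseq (count_mem x s) x | x <- enum T]) s.
Proof.
apply/allP => x _ /=; rewrite count_flatten sumnE !big_map -enumT.
rewrite (bigD1_seq x) ?mem_enum ?enum_uniq //= big1 => [|y yx].
  by rewrite count_nseq /= eqxx mul1n addn0.
by rewrite count_nseq /= (negbTE yx).
Qed.

Lemma sorted_space_dirs (d : nat) (s : seq 'I_d) :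
  exists2 r : seq 'I_d, perm_eq s r &
    flatten [seq nseq (count_mem i (map (lshift 1) s)) i | i <- enum 'I_(d + 1)]
    = map (lshift 1) r.
Proof.
set r := flatten _; have rs := perm_flatten_nseq (map (lshift 1) s).
(* Partial inverse of [lshift 1], undefined at the time index, which does not occur in [r]. *)
pose g (i : 'I_(d + 1)) : option 'I_d :=
  if fintype.split i is inl k then Some k else None.
have E : r = map (lshift 1) (pmap g r).
  have /pmap_filter -> : ocancel g (lshift 1).
    by move=> i; rewrite /g; case: splitP => //= k ik; exact/val_inj.
  apply/esym/all_filterP/allP => i; rewrite (perm_mem rs) => /mapP[k _ ->].
  by rewrite /g -[lshift 1 k]/(unsplit (inl k)) unsplitK.
exists (pmap g r) => //; rewrite perm_sym.
by apply: (perm_map_inj (@lshift_inj d 1)); rewrite -E.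
Qed.

(** Sorting [s] turns the derivative into the multi-index derivative whose exponents count the
    entries of [s], with exponent 0 for time. *)
Lemma iterated_partial_bounded (R : realType) (d : nat)
    (f : 'rV[R]_d * R -> 'rV[R]_d) (t : R) (j : 'I_d) (s : seq 'I_d) :
  smooth_on (@slab R d) f ->
  (forall beta : 'I_(d + 1) -> nat, exists M : R,
    forall p : 'rV[R]_d * R, slab p ->
      `|multi_partial_on (@slab R d) beta f p| <= M) ->
  0 <= t <= 1 ->
  exists M : R, forall x, `|iterated_partial s (fun x => f (x, t) 0 j) x| <= M.
Proof.
move=> sf bf t01; have st := smooth_slice sf t01.
have [r sr E] := sorted_space_dirs s.
have [M HM] := bf (fun i => count_mem i (map (lshift 1) s)).
exists M => x; rewrite (iterated_partial_perm (smooth_coord j st) sr).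
rewrite iterated_partial_coord // -iterated_partial_slab //.
have /HM : slab (x, t) by [].
rewrite /multi_partial_on E; apply: le_trans.
exact: coord_norm_le.
Qed.

(** * Derivatives of coordinates and of the logit *)

Lemma coord_delta (R : realType) (d : nat) (i k : 'I_d) :
  (delta_mx 0 k : 'rV[R]_d) 0 i = (i == k)%:R.
Proof. by rewrite mxE eqxx. Qed.

Lemma is_derive_coord (R : realType) (d : nat) (x v : 'rV[R]_d) (i : 'I_d) :
  is_derive x v (fun y : 'rV[R]_d => y 0 i) (v 0 i).
Proof.
split; first exact/diff_derivable/differentiable_coord.
have := @derive_mx _ _ _ _ id x v (@derivable_id _ _ _ _).
by rewrite derive_id => /matrixP/(_ 0 i); rewrite mxE.
Qed.

Lemma is_derive_comp_coord (R : realType) (d : nat) (f : R -> R) (df : R)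
    (x v : 'rV[R]_d) (i : 'I_d) :
  is_derive (x 0 i) 1 f df ->
  is_derive x v (fun y : 'rV[R]_d => f (y 0 i)) (v 0 i * df).
Proof.
move=> [/derivable1_diffP diff_f f_df].
have diff_i : differentiable (fun y : 'rV[R]_d => y 0 i) x.
  exact: differentiable_coord.
have diff_fi := differentiable_comp diff_i diff_f.
split; first exact: diff_derivable.
rewrite (deriveE _ diff_fi) diff_comp //= -(deriveE v diff_i).
rewrite (@derive_val _ _ _ _ _ _ _ (is_derive_coord x v i)).
by rewrite diff1E // derive1E f_df.
Qed.

Definition logit_weight (R : realType) (u : R) : R := (u * (1 - u))^-1.

Lemma is_derive_Glogit (R : realType) (u : R) :
  0 < u < 1 -> is_derive u 1 (@Glogit R) (logit_weight u).
Proof.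
move=> /andP[u0 u1]; have u10 : 0 < 1 - u by rewrite subr_gt0.
have dquot : is_derive u 1 (fun u : R => u / (1 - u)) ((1 - u) ^- 2).
  have n0 : 1 - u != 0 by rewrite gt_eqF.
  have d1 : is_derive u 1 (fun u : R => 1 - u) (- 1).
    have := is_deriveB (is_derive_cst (1 : R) u 1) (is_derive_id u 1).
    by rewrite sub0r.
  have dV : is_derive u 1 (fun u : R => (1 - u)^-1) (- (1 - u) ^- 2 *: - 1).
    exact: is_deriveV.
  apply: (is_derive_eq (is_deriveM (is_derive_id u 1) dV)).
  by rewrite /GRing.scale /=; field.
have quot0 : 0 < u / (1 - u) by rewrite divr_gt0.
change (is_derive u 1 (@ln R \o (fun u => u / (1 - u))) (logit_weight u)).
apply: (is_derive_eq (@is_derive1_comp _ (@ln R) (fun u => u / (1 - u)) _ _ _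
  (is_derive1_ln quot0) dquot)).
by rewrite /logit_weight; field; rewrite !gt_eqF.
Qed.

(** * The algebra of weighted-smooth functions *)

(** No bound on [f] itself is asked, so that the logit and the components of [tau] are covered. The
    parameter [P] lets [weighted_smooth] recurse through this definition. *)
Definition weighted_gradient (R : realType) (d : nat)
    (P : ('rV[R]_d -> R) -> Prop) (f : 'rV[R]_d -> R) : Prop :=
  forall k : 'I_d, exists2 g, P g & forall u, open_cube u ->
    is_derive u (delta_mx 0 k) f (logit_weight (u 0 k) * g u).

(* These are the functions of G(u) with bounded derivatives up to order n,
   phrased without leaving the cube. *)
Fixpoint weighted_smooth (R : realType) (d n : nat) (f : 'rV[R]_d -> R) :
    Prop :=
  (exists M, forall u, open_cube u -> `|f u| <= M) /\
  (if n is n'.+1 then weighted_gradient (weighted_smooth n') f else True).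

Lemma weighted_smooth_bounded (R : realType) (d n : nat) (f : 'rV[R]_d -> R) :
  weighted_smooth n f -> exists M, forall u, open_cube u -> `|f u| <= M.
Proof. by case: n => [|n] []. Qed.

Lemma weighted_smoothW (R : realType) (d m n : nat) (f : 'rV[R]_d -> R) :
  (m <= n)%N -> weighted_smooth n f -> weighted_smooth m f.
Proof.
elim: n m f => [|n IH] [|m] f //= mn [bf gf]; split=> // k.
by have [g wg dg] := gf k; exists g => //; exact: IH wg.
Qed.

Lemma weighted_smooth_cst (R : realType) (d n : nat) (c : R) :
  weighted_smooth n (fun _ : 'rV[R]_d => c).
Proof.
elim: n c => [|n IH] c; (split; first by exists `|c|) => // k.
exists (fun=> 0) => // u _; rewrite mulr0; exact: is_derive_cst.
Qed.

Lemma weighted_smoothD (R : realType) (d n : nat) (f g : 'rV[R]_d -> R) :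
  weighted_smooth n f -> weighted_smooth n g ->
  weighted_smooth n (fun u => f u + g u).
Proof.
elim: n f g => [|n IH] f g [[M bf] gf] [[M' bg] gg]; (split;
  first by exists (M + M') => u cu; rewrite (le_trans (ler_normD _ _)) ?lerD
    ?bf ?bg) => // k.
have [f' wf df] := gf k; have [g' wg dg] := gg k.
exists (fun u => f' u + g' u); first exact: IH.
move=> u cu; rewrite mulrDr.
exact: (is_deriveD (df u cu) (dg u cu)).
Qed.

Lemma weighted_smoothM (R : realType) (d n : nat) (f g : 'rV[R]_d -> R) :
  weighted_smooth n f -> weighted_smooth n g ->
  weighted_smooth n (fun u => f u * g u).
Proof.
elim: n f g => [|n IH] f g wsf wsg;
  have [[M bf] gf] := wsf; have [[M' bg] gg] := wsg; (split;
  first by exists (M * M') => u cu; rewrite normrM ler_pM ?bf ?bg) => // k.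
have [f' wf df] := gf k; have [g' wg dg] := gg k.
(* The undifferentiated factors are known to order n + 1 and are used at order n. *)
exists (fun u => f u * g' u + g u * f' u).
  apply: weighted_smoothD; apply: IH => //.
    exact: (@weighted_smoothW _ _ _ n.+1).
  exact: (@weighted_smoothW _ _ _ n.+1).
move=> u cu; apply: (is_derive_eq (is_deriveM (df u cu) (dg u cu))).
by rewrite /GRing.scale /=; ring.
Qed.

Lemma weighted_smooth_sum (R : realType) (d n : nat) (I : Type) (r : seq I)
    (f : I -> 'rV[R]_d -> R) :
  (forall i, weighted_smooth n (f i)) ->
  weighted_smooth n (fun u => \sum_(i <- r) f i u).
Proof.
move=> wf; elim: r => [|i r IH].
  under eq_fun do rewrite big_nil; exact: weighted_smooth_cst.
by under eq_fun do rewrite big_cons; exact: weighted_smoothD.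
Qed.

Lemma weighted_smooth_coord (R : realType) (d n : nat) (i : 'I_d) :
  weighted_smooth n (fun u : 'rV[R]_d => u 0 i).
Proof.
elim: n => [|n IH]; (split; first by exists 1 => u /(_ i) /andP[u0 u1];
  rewrite gtr0_norm ?ltW) => // k.
(* 1 = w(u_i) * (u_i (1 - u_i)) *)
exists (fun u => (u 0 i * (1 - u 0 i)) * (i == k)%:R).
  apply: weighted_smoothM; last exact: weighted_smooth_cst.
  apply: weighted_smoothM => //; apply: weighted_smoothD.
    exact: weighted_smooth_cst.
  under eq_fun do rewrite -mulN1r.
  by apply: weighted_smoothM => //; exact: weighted_smooth_cst.
move=> u cu; apply: (is_derive_eq (is_derive_coord _ _ i)).
rewrite coord_delta; have [->|] := eqVneq i k; last by rewrite !mulr0.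
have /andP[u0 u1] := cu k.
rewrite !mulr1 /logit_weight mulVf // mulf_neq0 ?gt_eqF // subr_gt0 //.
Qed.

(** * Compositions and Euler steps *)

Definition smooth_bounded (R : realType) (d : nat) (f : 'rV[R]_d -> R) : Prop :=
  smooth f /\ forall s, exists M, forall x, `|iterated_partial s f x| <= M.

Lemma smooth_bounded_partial (R : realType) (d : nat) (f : 'rV[R]_d -> R)
    (i : 'I_d) :
  smooth_bounded f -> smooth_bounded ('D_(delta_mx 0 i) f).
Proof.
have E s : iterated_partial s ('D_(delta_mx 0 i) f) =
    iterated_partial (rcons s i) f by rewrite /iterated_partial foldr_rcons.
by move=> [sf bf]; split=> s; rewrite E.
Qed.

(** Each partial derivative of [f] is again smooth and bounded, so the chain rule permits induction
    on [n] for all [f] at once. The gradient of [g] has order [n.-1] because forming it spends one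
    derivative. *)
Lemma weighted_smooth_comp (R : realType) (d n : nat) (f : 'rV[R]_d -> R)
    (g : 'rV[R]_d -> 'rV[R]_d) :
  smooth_bounded f ->
  (forall i,
    weighted_gradient (@weighted_smooth R d n.-1) (fun u => g u 0 i)) ->
  weighted_smooth n (fun u => f (g u)).
Proof.
elim: n f => [|n IH] f [sf bf] wg; (split;
  first by have [M HM] := bf [::]; exists M => u _; exact: HM) => // k.
have /choice[G HG] (i : 'I_d) : exists G, weighted_smooth n G /\
  forall u, open_cube u -> is_derive u (delta_mx 0 k) (fun u => g u 0 i)
    (logit_weight (u 0 k) * G u).
  by have [G ? ?] := wg i k; exists G.
exists (fun u => \sum_i 'D_(delta_mx 0 i) f (g u) * G i u).
  apply: weighted_smooth_sum => i.
  apply: weighted_smoothM; last by case: (HG i).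
  apply: (IH ('D_(delta_mx 0 i) f)); first exact: smooth_bounded_partial.
  move=> j l; have [h wh dh] := wg j l; exists h => //.
  by apply: weighted_smoothW wh; exact: leq_pred.
move=> u cu; apply: (is_derive_eq (@is_derive_comp_partials R d _ f g u _
    (fun i => logit_weight (u 0 k) * G i u) _ _ _)).
  - by move=> x i; case: (sf [::]).
  - by move=> i; case: (sf [:: i]).
  - by move=> i; case: (HG i) => _; exact.
by rewrite mulr_sumr; apply: eq_bigr => i _; rewrite mulrCA.
Qed.

Lemma weighted_gradient_Glogit (R : realType) (d n : nat) (i : 'I_d) :
  weighted_gradient (@weighted_smooth R d n) (fun u => Glogit (u 0 i)).
Proof.
move=> k; exists (fun=> (i == k)%:R); first exact: weighted_smooth_cst.
move=> u cu.
apply: (is_derive_eq (is_derive_comp_coord _ (is_derive_Glogit (cu i)))).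
by rewrite coord_delta mulrC; have [->|_] := eqVneq i k; rewrite ?mulr0.
Qed.

Lemma weighted_gradient_euler_iter (R : realType) (d N : nat)
    (vtheta : 'rV[R]_d * R -> 'rV[R]_d) :
  (forall (k : nat) (i : 'I_d), (k < N)%N ->
    smooth_bounded (fun x => vtheta (x, k%:R * N%:R^-1) 0 i)) ->
  forall k : nat, (k <= N)%N -> forall (n : nat) (i : 'I_d),
  weighted_gradient (@weighted_smooth R d n)
    (fun u => euler_iter N vtheta k (map_mx (@Glogit R) u) 0 i).
Proof.
move=> sbv; elim=> [|k IH] kN n i /=.
  by under eq_fun do rewrite mxE; exact: weighted_gradient_Glogit.
(* The velocity term is taken at order n + 1 so that its gradient has order n. *)
have [_ grad_v] := @weighted_smooth_comp R d n.+1 _ _ (sbv k i kN)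
  (IH (ltnW kN) n).
move=> l; have [g wg dg] := IH (ltnW kN) n i l.
have [g' wg' dg'] := grad_v l.
exists (fun u => g u + N%:R^-1 * g' u).
  apply: weighted_smoothD => //; apply: weighted_smoothM => //.
  exact: weighted_smooth_cst.
move=> u cu; rewrite /euler_step; under eq_fun do rewrite !mxE.
apply: (is_derive_eq (is_deriveD (dg u cu) (is_deriveZ N%:R^-1 (dg' u cu)))).
by rewrite /GRing.scale /=; ring.
Qed.

(** * Differentiating products of weights *)

Lemma near_open_cube (R : realType) (d : nat) (u : 'rV[R]_d) :
  open_cube u -> \forall w \near u, open_cube w.
Proof.
move=> cu.
suff H (k : 'I_d) : \forall w \near u, 0 < (w : 'rV[R]_d) 0 k < 1.
  exact: (@filter_forall _ _ _ _ (nbhs_filter u) H).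
have /andP[u0 u1] := cu k.
have ck := @coord_continuous R 1 d 0 k u.
have H0 : \forall w \near u, 0 < (w : 'rV[R]_d) 0 k by exact: (cvgr_gt _ ck).
have H1 : \forall w \near u, (w : 'rV[R]_d) 0 k < 1 by exact: (cvgr_lt _ ck).
by apply: (@filterS2 _ _ (nbhs_filter u) _ _ _ _ H0 H1) => w w0 w1; apply/andP.
Qed.

Lemma is_derive_logit_weight (R : realType) (u : R) :
  0 < u < 1 ->
  is_derive u 1 (@logit_weight R)
    (logit_weight u * (logit_weight u * (2 * u - 1))).
Proof.
move=> /andP[u0 u1]; have n1 : u != 0 by rewrite gt_eqF.
have n2 : 1 - u != 0 by rewrite gt_eqF // subr_gt0.
have d1 := is_deriveB (is_derive_cst (1 : R) u 1) (is_derive_id u 1).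
have n3 : (id * (cst 1 - id)) u != 0 :> R by rewrite mulf_neq0.
apply: (is_derive_eq (is_deriveV n3 (is_deriveM (is_derive_id u 1) d1))).
rewrite /logit_weight /GRing.scale /=.
rewrite -[(id * (cst 1 - id)) u]/(u * (1 - u)) -[(cst 1 - id) u]/(1 - u).
by field; rewrite n1 n2.
Qed.

(** Indexed by a sequence because a direction may repeat, as [m] does when it lies in [v]. *)
Definition weight_prod (R : realType) (d : nat) (r : seq 'I_d)
    (u : 'rV[R]_d) : R :=
  \prod_(i <- r) logit_weight (u 0 i).

Lemma is_derive_weight_prod (R : realType) (d : nat) (r : seq 'I_d)
    (u : 'rV[R]_d) (k : 'I_d) :
  open_cube u ->
  is_derive u (delta_mx 0 k) (weight_prod r)
    (logit_weight (u 0 k) * (weight_prod r u *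
      (\sum_(i <- r) (i == k)%:R * (2 * u 0 i - 1)))).
Proof.
move=> cu; rewrite /weight_prod; elim: r => [|i r IH].
  under eq_fun do rewrite big_nil.
  by rewrite !big_nil !mulr0; exact: is_derive_cst.
under eq_fun do rewrite big_cons.
have di := is_derive_comp_coord (delta_mx 0 k) (is_derive_logit_weight (cu i)).
apply: (is_derive_eq (is_deriveM di IH)).
rewrite /GRing.scale /= coord_delta !big_cons.
by have [->|_] := eqVneq i k; rewrite ?mulr1n ?mulr0n; ring.
Qed.

(** Each derivative spends one order of smoothness of the factor and adds one weight to the
    product. *)
Lemma iterated_partial_weighted (R : realType) (d n : nat) (s r : seq 'I_d)
    (h F : 'rV[R]_d -> R) :
  weighted_smooth (size s + n) F ->
  (forall u, open_cube u -> h u = F u * weight_prod r u) ->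
  exists2 F', weighted_smooth n F' &
    forall u, open_cube u ->
      iterated_partial s h u = F' u * weight_prod (s ++ r) u.
Proof.
move=> wF hF; elim: s n wF => [|k s IH] n wF /=; first by exists F.
have [|G wG hG] := IH n.+1; first by rewrite addnS.
have [_ gG] := wG; have [G' wG' dG] := gG k.
(* Product rule: the first term differentiates [G], the second the weights; the common factor w(u_k)
   joins the product. *)
exists (fun u => G' u + G u *
    (\sum_(i <- s ++ r) (i == k)%:R * (2 * u 0 i - 1))).
  apply: weighted_smoothD => //; apply: weighted_smoothM.
    exact: weighted_smoothW wG.
  apply: weighted_smooth_sum => i; apply: weighted_smoothM.
    exact: weighted_smooth_cst.
  apply: weighted_smoothD; last exact: weighted_smooth_cst.
  apply: weighted_smoothM; first exact: weighted_smooth_cst.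
  exact: weighted_smooth_coord.
move=> u cu.
have dP := is_deriveM (dG u cu) (@is_derive_weight_prod R d (s ++ r) u k cu).
(* The identity is known only on the cube; openness makes it hold near [u], so it may be
   differentiated. *)
have near_hG : \forall w \near u,
    (G * weight_prod (s ++ r)) w = iterated_partial s h w.
  by apply: filterS (near_open_cube cu) => w /hG ->.
rewrite (@derive_val _ _ _ _ _ _ _ (near_eq_is_derive near_hG dP)).
by rewrite /GRing.scale /= /weight_prod big_cons; ring.
Qed.

(** * Estimates by the distance to the boundary, and the theorem *)

(** The larger of u and 1 - u is at least 1/2, so u (1 - u) is at least half the smaller. *)
Lemma logit_weight_le (R : realType) (u : R) :
  0 < u < 1 -> 0 <= logit_weight u <= 2 * (Num.min u (1 - u))^-1.
Proof.
move=> /andP[u0 u1]; have u10 : 0 < 1 - u by rewrite subr_gt0.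
have m0 : 0 < Num.min u (1 - u) by rewrite lt_min u0.
rewrite /logit_weight invr_ge0 mulr_ge0 ?(ltW u0) ?(ltW u10) //=.
have -> : 2 * (Num.min u (1 - u))^-1 = (2^-1 * Num.min u (1 - u))^-1.
  by rewrite invfM invrK.
rewrite lef_pV2 ?posrE ?mulr_gt0 ?invr_gt0 //.
by case: (leP u (1 - u)) => H; nra.
Qed.

Lemma weight_prod_le (R : realType) (d : nat) (r : seq 'I_d) (u : 'rV[R]_d) :
  open_cube u ->
  0 <= weight_prod r u <=
  2 ^+ size r * \prod_(i <- r) (Num.min (u 0 i) (1 - u 0 i))^-1.
Proof.
move=> cu; rewrite /weight_prod; elim: r => [|i r /andP[P0 IH]].
  by rewrite !big_nil mulr1 ler01 lexx.
have /andP[w0 w1] := logit_weight_le (cu i).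
rewrite !big_cons mulr_ge0 //= exprS mulrACA.
exact: ler_pM.
Qed.

(** The base lies in (0, 1], so lowering the exponent raises the power: from -1 to -B - 1 for k in
    [v], from 0 to -B otherwise. *)
Lemma prod_min_powR_le (R : realType) (d : nat) (v : {set 'I_d}) (B : R)
    (u : 'rV[R]_d) :
  0 <= B -> open_cube u ->
  \prod_(i <- enum v) (Num.min (u 0 i) (1 - u 0 i))^-1 <=
  \prod_(k < d) (Num.min (u 0 k) (1 - u 0 k)) `^ (- B - (k \in v)%:R).
Proof.
move=> B0 cu; rewrite big_enum /= big_mkcond /=; apply: ler_prod => k _.
have /andP[u0 u1] := cu k; set a := Num.min _ _.
have a0 : 0 < a by rewrite lt_min u0 subr_gt0.
have a1 : 0 < a <= 1 by rewrite a0 ge_min ltW.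
case: ifP => _.
  rewrite invr_ge0 (ltW a0) /= -(powR_inv1 (ltW a0)).
  by apply: ger_powR => //; rewrite gerDr oppr_le0.
by rewrite ler01 /= -(powRr0 a); apply: ger_powR => //; rewrite subr0 oppr_le0.
Qed.

Unset Implicit Arguments.

Theorem theorem16 (R : realType) (d N : nat) (hd : (1 <= d)%N) (hN : (1 <= N)%N)
    (vtheta : 'rV[R]_d * R -> 'rV[R]_d)
    (vtheta_smooth : smooth_on (@slab R d) vtheta)
    (vtheta_bounded : forall beta : 'I_(d + 1) -> nat, exists M : R,
       forall p : 'rV[R]_d * R, slab p ->
         `|multi_partial_on (@slab R d) beta vtheta p| <= M) :
  forall (m j : 'I_d) (v : {set 'I_d}) (B : R), 0 < B ->
  exists C3 : R, 0 < C3 /\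
  forall u : 'rV[R]_d, open_cube u ->
    `|mixed_partial v (mixed_partial [set m]%SET
                         (fun w => tau N vtheta w 0 j)) u|
    <= C3 * (Num.min (u 0 m) (1 - u 0 m))^-1
       * \prod_(k < d) (Num.min (u 0 k) (1 - u 0 k)) `^ (- B - (k \in v)%:R).
Proof.
move=> m j v B B0.
have sbv (k : nat) (i : 'I_d) : (k < N)%N ->
    smooth_bounded (fun x => vtheta (x, k%:R * N%:R^-1) 0 i).
  move=> kN; have t01 : 0 <= (k%:R * N%:R^-1 : R) <= 1.
    by rewrite mulr_ge0 ?invr_ge0 //= ler_pdivrMr ?ltr0n // mul1r ler_nat ltnW.
  split; first exact/smooth_coord/(smooth_slice vtheta_smooth).
  by move=> s; exact: iterated_partial_bounded.
set n := size (enum v).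
(* One order for each derivative in [v]; the remaining order 0 is boundedness. *)
have [G wG dG] := weighted_gradient_euler_iter sbv (leqnn N) (n + 0) j m.
(* The derivative in [m] has already produced one weight, hence the initial list [[:: m]]. *)
have [||F wF EF] := @iterated_partial_weighted R d 0 (enum v) [:: m]
  (mixed_partial [set m]%SET (fun w => tau N vtheta w 0 j)) G.
- exact: wG.
- move=> u cu; rewrite /mixed_partial enum_set1 /=.
  rewrite (@derive_val _ _ _ _ _ _ _ (dG u cu)) mulrC.
  by rewrite /weight_prod big_seq1.
have [M bF] := weighted_smooth_bounded wF.
(* A factor 2 for each weight, from [logit_weight_le]; |M| + 1 bounds [F] and is positive. *)
exists ((`|M| + 1) * 2 ^+ (size (enum v ++ [:: m]))); split.
  by rewrite mulr_gt0 ?exprn_gt0 // ltr_wpDl.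
move=> u cu; rewrite [mixed_partial v _ u]EF // normrM.
have /andP[P0 Ple] := weight_prod_le (enum v ++ [:: m]) cu.
rewrite (ger0_norm P0) -2!mulrA; apply: ler_pM => //.
  by apply: le_trans (bF u cu) _; rewrite ler_wpDr // ler_norm.
apply: le_trans Ple _; rewrite ler_pM2l ?exprn_gt0 // big_cat big_seq1 mulrC /=.
have /andP[u0 u1] := cu m.
rewrite ler_pM2r; first exact: prod_min_powR_le (ltW B0) cu.
by rewrite invr_gt0 lt_min u0 subr_gt0.
Qed.
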